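(* Let $(E,\tau)$ be a locally solid vector lattice, where $\tau$ is a Fatou topology. Then $C_\tau=E$ holds whenever $E$ has the countable sup property, whenever $C_\tau$ has a countable order basis, and whenever $\tau$ is metrisable. Suppose that $C_\tau=E$, and let $\tau^\delta$ be the extension of $\tau$ to a Fatou topology on the Dedekind completion $E^\delta$ of $E$. Then $\tau^\delta$ is locally interval complete solidly submetrisable.
   Context: All vector lattices are real and Archimedean; linear topologies are Hausdorff. A locally solid topology on a vector lattice is a linear topology such that zero has a neighbourhood basis of solid sets. A subset is order closed if it contains the order limits of nets in it. A Fatou topology is a locally solid topology in which zero has a neighbourhood basis of order closed solid sets; for a Fatou topology $\tau$ on $E$ there is a unique Fatou topology $\tau^\delta$ on $E^\delta$ extending it. A sequence $(V_n)$ of neighbourhoods of zero is normal if $V_{n+1}+V_{n+1}\subseteq V_n$; the carrier $C_\tau$ is the union of the disjoint complements $N^{\mathrm d}$ where $N=\bigcap_n V_n$ ranges over intersections of normal sequences of solid $\tau$-neighbourhoods of zero. An order basis of a vector lattice $G$ is a non-empty $A\subseteq G$ with $A^{\mathrm d}=\{0\}$. $E$ has the countable sup property if every subset with a supremum contains an at most countable subset with the same supremum. A locally solid topology $\sigma$ on a vector lattice $G$ is locally interval complete solidly submetrisable if for every $x\in G^+$ there is a metrisable locally solid topology $\widetilde\sigma_x$ on the band $B_x$ generated by $x$, coarser than $\sigma|_{B_x}$, such that every $\widetilde\sigma_x$-Cauchy sequence in $[0,x]$ is $\widetilde\sigma_x$-convergent to an element of $[0,x]$. *)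

(* Defs.v *)
From HB Require Import structures.
From mathcomp Require Import all_boot all_order all_algebra.
From mathcomp Require Import all_classical all_reals.
From Stdlib Require Import ClassicalEpsilon.
Set Implicit Arguments. Unset Strict Implicit. Unset Printing Implicit Defensive.
Import Order.TTheory GRing.Theory Num.Theory.
Local Open Scope ring_scope.
Local Open Scope classical_set_scope.

Section VectorLattices.
Context {R : realType} {V : lmodType R}.
Variable le : V -> V -> Prop.

Definition vl_ub (A : set V) (s : V) := forall a, A a -> le a s.
Definition vl_lb (A : set V) (s : V) := forall a, A a -> le s a.
Definition vl_is_sup (A : set V) (s : V) :=
  vl_ub A s /\ forall t, vl_ub A t -> le s t.
Definition vl_is_inf (A : set V) (s : V) :=
  vl_lb A s /\ forall t, vl_lb A t -> le t s.

Definition vector_lattice : Prop :=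
  (forall x, le x x) /\
  (forall x y, le x y -> le y x -> x = y) /\
  (forall x y z, le x y -> le y z -> le x z) /\
  (forall x y z, le x y -> le (x + z) (y + z)) /\
  (forall (a : R) x y, 0 <= a -> le x y -> le (a *: x) (a *: y)) /\
  (forall x y, exists s, vl_is_sup (fun z => z = x \/ z = y) s).

Definition archimedean : Prop :=
  forall x y, le 0 x -> (forall n : nat, le (x *+ n) y) -> x = 0.

Definition dedekind_complete : Prop :=
  forall A : set V, (exists a, A a) -> (exists b, vl_ub A b) ->
    exists s, vl_is_sup A s.

(* lattice operations (well defined on a vector lattice) *)
Definition vjoin (x y : V) : V :=
  epsilon (inhabits 0) (vl_is_sup (fun z => z = x \/ z = y)).
Definition vmeet (x y : V) : V := - vjoin (- x) (- y).
Definition vabs (x : V) : V := vjoin x (- x).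
Definition vdisj (x y : V) : Prop := vmeet (vabs x) (vabs y) = 0.
Definition dcompl (A : set V) : set V := fun x => forall y, A y -> vdisj x y.

Definition solid_in (G S : set V) : Prop :=
  S `<=` G /\ forall x y, S x -> G y -> le (vabs y) (vabs x) -> S y.

Definition vl_directed (I : Type) (r : I -> I -> Prop) : Prop :=
  (exists i : I, True) /\ (forall i, r i i) /\
  (forall i j k, r i j -> r j k -> r i k) /\
  (forall i j, exists k, r i k /\ r j k).

Definition order_conv (I : Type) (r : I -> I -> Prop) (x : I -> V) (l : V)
  : Prop :=
  exists (J : Type) (s : J -> J -> Prop) (y : J -> V),
    vl_directed s /\ (forall b1 b2, s b1 b2 -> le (y b2) (y b1)) /\
    vl_is_inf (range y) 0 /\
    forall b, exists a0, forall a, r a0 a -> le (vabs (x a - l)) (y b).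

Definition order_closed (S : set V) : Prop :=
  forall (I : Type) (r : I -> I -> Prop) (x : I -> V) (l : V),
    vl_directed r -> (forall i, S (x i)) -> order_conv r x l -> S l.

Definition order_basis (G A : set V) : Prop :=
  (exists a, A a) /\ A `<=` G /\
  forall x, G x -> (forall a, A a -> vdisj x a) -> x = 0.

Definition countable_sup_property : Prop :=
  forall (A : set V) s, vl_is_sup A s ->
    exists A0, A0 `<=` A /\ countable A0 /\ vl_is_sup A0 s.

Definition band_gen (x : V) : set V := dcompl (dcompl (fun z => z = x)).
Definition vinterval (x : V) : set V := fun y => le 0 y /\ le y x.
End VectorLattices.

(* Linear (Hausdorff) topologies on a linear subspace G of V, represented by
   their filter of neighbourhoods of zero (subsets of G). *)
Section Topologies.
Context {R : realType} {V : lmodType R}.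

Definition lin_subspace (G : set V) : Prop :=
  G 0 /\ (forall x y, G x -> G y -> G (x + y)) /\
  (forall (a : R) x, G x -> G (a *: x)).

Definition linear_top (G : set V) (M : set (set V)) : Prop :=
  lin_subspace G /\
  (forall U, M U -> U `<=` G) /\ M G /\
  (forall U W, M U -> U `<=` W -> W `<=` G -> M W) /\
  (forall U W, M U -> M W -> M (U `&` W)) /\
  (forall U, M U -> U 0) /\
  (forall U, M U -> exists W, M W /\ forall x y, W x -> W y -> U (x + y)) /\
  (forall U, M U -> exists W, M W /\ W `<=` U /\
     forall (a : R) x, `|a| <= 1 -> W x -> W (a *: x)) /\
  (forall U x, M U -> G x -> exists t : R, 0 < t /\
     forall a : R, `|a| <= t -> U (a *: x)) /\
  (forall x, G x -> x <> 0 -> exists U, M U /\ ~ U x).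

Definition metrisable (G : set V) (M : set (set V)) : Prop :=
  exists d : V -> V -> R,
    (forall x y, G x -> G y -> 0 <= d x y) /\
    (forall x y, G x -> G y -> (d x y = 0 <-> x = y)) /\
    (forall x y, G x -> G y -> d x y = d y x) /\
    (forall x y z, G x -> G y -> G z -> d x z <= d x y + d y z) /\
    forall x (U : set V), G x -> U `<=` G ->
      ((exists W, M W /\ forall w, W w -> U (x + w)) <->
       (exists e : R, 0 < e /\ forall y, G y -> d x y < e -> U y)).

Definition top_cauchy (M : set (set V)) (u : nat -> V) : Prop :=
  forall W, M W -> exists n0, forall m n, (n0 <= m)%N -> (n0 <= n)%N ->
    W (u m - u n).
Definition top_conv (M : set (set V)) (u : nat -> V) (y : V) : Prop :=
  forall W, M W -> exists n0, forall n, (n0 <= n)%N -> W (u n - y).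

Variable le : V -> V -> Prop.

Definition locally_solid (G : set V) (M : set (set V)) : Prop :=
  linear_top G M /\
  forall U, M U -> exists W, M W /\ W `<=` U /\ solid_in le G W.

Definition fatou (M : set (set V)) : Prop :=
  locally_solid setT M /\
  forall U, M U -> exists W, M W /\ W `<=` U /\ solid_in le setT W /\
    order_closed le W.

Definition normal_solid_seq (M : set (set V)) (Vs : nat -> set V) : Prop :=
  forall n, M (Vs n) /\ solid_in le setT (Vs n) /\
    forall x y, Vs n.+1 x -> Vs n.+1 y -> Vs n (x + y).

Definition carrier (M : set (set V)) : set V :=
  fun x => exists Vs, normal_solid_seq M Vs /\
    dcompl le (fun y => forall n, Vs n y) x.

Definition lic_solidly_submetrisable (M : set (set V)) : Prop :=
  forall x, le 0 x -> exists Mx : set (set V),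
    locally_solid (band_gen le x) Mx /\ metrisable (band_gen le x) Mx /\
    (forall W, Mx W -> exists U, M U /\ U `&` band_gen le x `<=` W) /\
    forall u : nat -> V, (forall n, vinterval le x (u n)) -> top_cauchy Mx u ->
      exists y, vinterval le x y /\ top_conv Mx u y.
End Topologies.

Definition dedekind_completion {R : realType} {E F : lmodType R}
  (le : E -> E -> Prop) (leF : F -> F -> Prop) (j : E -> F) : Prop :=
  vector_lattice leF /\ dedekind_complete leF /\
  (forall (a : R) x y, j (a *: x + y) = a *: j x + j y) /\
  injective j /\
  (forall x y, le x y <-> leF (j x) (j y)) /\
  (forall x y, j (vjoin le x y) = vjoin leF (j x) (j y)) /\
  (forall y, leF 0 y -> y <> 0 -> exists x, leF 0 (j x) /\ j x <> 0 /\ leF (j x) y) /\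
  (forall y, exists x, leF y (j x)).

Definition top_extends {R : realType} {E F : lmodType R} (j : E -> F)
  (N : set (set E)) (Nd : set (set F)) : Prop :=
  forall U, N U <-> exists W, Nd W /\ j @^-1` W `<=` U.

(* Main.v *)
(* Since [tau] is Fatou, the kernel of a normal sequence of order closed solid
   neighbourhoods is a band, and in an Archimedean vector lattice a band not
   containing [x] misses some non-zero part of [|x|]; so the carrier is order
   dense. Countably many normal sequences can be merged into one, and this turns
   each of the three countability hypotheses into [C_tau = E].
   If [C_tau = E] and [x <= j e], a normal sequence witnessing that [e] is in the
   carrier yields order closed solid neighbourhoods [W n] in the completion whose
   kernel meets [B_x] trivially; their traces on [B_x] define the metrisable
   topology. For a Cauchy sequence in [[0, x]] the truncated sums of increments of
   a fast subsequence have suprema, by order closedness still in [W n], and these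
   control the distance to the limit. *)
Require Import Defs.
From HB Require Import structures.
From mathcomp Require Import all_boot all_order all_algebra.
From mathcomp Require Import all_classical all_reals.
From Stdlib Require ClassicalEpsilon.
Set Implicit Arguments. Unset Strict Implicit. Unset Printing Implicit Defensive.
Import Order.TTheory GRing.Theory Num.Theory.
Local Open Scope ring_scope.
Local Open Scope classical_set_scope.

(** * Order, modulus and disjointness in a vector lattice *)

Section VectorLatticeTheory.
Context {R : realType} {V : lmodType R} {le : V -> V -> Prop}.
Context (vl : vector_lattice le).
Implicit Types (x y z w : V) (A B S : set V).

Lemma vle_refl x : le x x.
Proof. by case: vl => h _; exact: h. Qed.

Lemma vle_anti x y : le x y -> le y x -> x = y.
Proof. by case: vl => _ [h _]; exact: h. Qed.

Lemma vle_trans y x z : le x y -> le y z -> le x z.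
Proof. by case: vl => _ [_ [h _]]; exact: h. Qed.

Lemma vle_add2r z x y : le x y -> le (x + z) (y + z).
Proof. by case: vl => _ [_ [_ [h _]]]; exact: h. Qed.

Lemma vle_scale (a : R) x y : 0 <= a -> le x y -> le (a *: x) (a *: y).
Proof. by case: vl => _ [_ [_ [_ [h _]]]]; exact: h. Qed.

Lemma vle_add x y z w : le x y -> le z w -> le (x + z) (y + w).
Proof.
move=> xy zw; apply: (vle_trans (vle_add2r z xy)).
by rewrite ![y + _]addrC; exact: vle_add2r.
Qed.

Lemma vle_subl_addr x y z : le (x - y) z <-> le x (z + y).
Proof.
by split=> [/(vle_add2r y)|/(vle_add2r (- y))]; rewrite ?subrK ?addrK.
Qed.

Lemma vle_subr_addr x y z : le x (z - y) <-> le (x + y) z.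
Proof.
by split=> [/(vle_add2r y)|/(vle_add2r (- y))]; rewrite ?subrK ?addrK.
Qed.

Lemma vsub_ge0 x y : le 0 (y - x) <-> le x y.
Proof. by rewrite vle_subr_addr add0r. Qed.

Lemma vle_opp x y : le x y -> le (- y) (- x).
Proof. by rewrite -(vsub_ge0 x) -(vsub_ge0 (- y)) opprK addrC. Qed.

Lemma vle_addl x y : le 0 y -> le x (y + x).
Proof. by move=> y0; rewrite -{1}[x]add0r; exact: vle_add2r. Qed.

Lemma vle_addr x y : le 0 y -> le x (x + y).
Proof. by rewrite addrC; exact: vle_addl. Qed.

Lemma vle_sub_id x y : le 0 y -> le (x - y) x.
Proof. by move=> y0; apply/vle_subl_addr/vle_addr. Qed.

Lemma vjoin_is_sup x y : vl_is_sup le (fun z => z = x \/ z = y) (vjoin le x y).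
Proof.
by case: vl => _ [_ [_ [_ [_ h]]]]; apply: ClassicalEpsilon.epsilon_spec; exact: h.
Qed.

Lemma vle_joinl x y : le x (vjoin le x y).
Proof. by have [h _] := vjoin_is_sup x y; apply: h; left. Qed.

Lemma vle_joinr x y : le y (vjoin le x y).
Proof. by have [h _] := vjoin_is_sup x y; apply: h; right. Qed.

Lemma vjoin_le x y z : le x z -> le y z -> le (vjoin le x y) z.
Proof.
by move=> xz yz; have [_ h] := vjoin_is_sup x y; apply: h => _ [->|->].
Qed.

Lemma vmeet_lel x y : le (vmeet le x y) x.
Proof. by rewrite -{2}[x]opprK; apply/vle_opp/vle_joinl. Qed.

Lemma vmeet_ler x y : le (vmeet le x y) y.
Proof. by rewrite -{2}[y]opprK; apply/vle_opp/vle_joinr. Qed.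

Lemma vle_meet x y z : le z x -> le z y -> le z (vmeet le x y).
Proof.
by move=> zx zy; rewrite -[z]opprK; apply/vle_opp/vjoin_le; exact: vle_opp.
Qed.

Lemma vle_abs x : le x (vabs le x).
Proof. exact: vle_joinl. Qed.

Lemma vle_absN x : le (- x) (vabs le x).
Proof. exact: vle_joinr. Qed.

Lemma vabs_le x z : le x z -> le (- x) z -> le (vabs le x) z.
Proof. exact: vjoin_le. Qed.

Lemma vabs_ge0 x : le 0 (vabs le x).
Proof.
(* The sum of the bounds for [x] and [- x] reads [0 <= 2 |x|], which is then halved. *)
have := vle_add (vle_abs x) (vle_absN x).
rewrite subrr -mulr2n -scaler_nat => /(@vle_scale (2^-1)).
by rewrite scaler0 scalerA mulVf ?pnatr_eq0// scale1r; apply; rewrite invr_ge0.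
Qed.

Lemma vabs_id x : le 0 x -> vabs le x = x.
Proof.
move=> x0; apply: vle_anti (vle_abs x); apply: vabs_le; first exact: vle_refl.
by apply: (vle_trans _ x0); rewrite -oppr0; apply: vle_opp.
Qed.

Lemma vabsN x : vabs le (- x) = vabs le x.
Proof.
apply: vle_anti; apply: vabs_le; rewrite ?opprK.
- exact: vle_absN.
- exact: vle_abs.
- by rewrite -{1}[x]opprK; exact: vle_absN.
- exact: vle_abs.
Qed.

Lemma vabsD x y : le (vabs le (x + y)) (vabs le x + vabs le y).
Proof.
apply: vabs_le; first by apply: vle_add; exact: vle_abs.
by rewrite opprD; apply: vle_add; exact: vle_absN.
Qed.

Lemma vabs_abs x : vabs le (vabs le x) = vabs le x.
Proof. exact/vabs_id/vabs_ge0. Qed.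

Lemma vabs0 : vabs le 0 = 0.
Proof. exact/vabs_id/vle_refl. Qed.

Lemma vabs_eq0 x : le (vabs le x) 0 -> x = 0.
Proof.
move=> h; apply: vle_anti; first exact: vle_trans (vle_abs x) h.
by rewrite -[x]opprK -oppr0; apply/vle_opp/(vle_trans _ h)/vle_absN.
Qed.

Lemma vabsZ (a : R) x : le (vabs le (a *: x)) (`|a| *: vabs le x).
Proof.
have hx (s : R) : (s = a \/ s = - a) -> le (s *: x) (`|a| *: vabs le x).
  move=> sa; have -> : `|a| = `|s| by case: sa => ->; rewrite ?normrN.
  case: (ger0P s) => s0; first by apply: vle_scale s0 _; exact: vle_abs.
  rewrite -[s *: x]opprK -scaleNr -scalerN.
  by apply: vle_scale; [rewrite oppr_ge0 ltW|exact: vle_absN].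
by apply: vabs_le; [apply: hx; left|rewrite -scaleNr; apply: hx; right].
Qed.

Lemma vle_scale1 (a : R) x : a <= 1 -> le 0 x -> le (a *: x) x.
Proof.
move=> a1 x0; apply/vsub_ge0; rewrite -{1}[x]scale1r -scalerBl.
by rewrite -(scaler0 _ (1 - a)); apply: vle_scale => //; rewrite subr_ge0.
Qed.

(** Disjointness becomes a statement about common lower bounds, which spares computations with
    [vmeet]. *)
Lemma vdisjP x y :
  vdisj le x y <-> forall z, le z (vabs le x) -> le z (vabs le y) -> le z 0.
Proof.
split=> [<- z|h]; first exact: vle_meet.
apply: vle_anti; first by apply: h; [exact: vmeet_lel|exact: vmeet_ler].
by apply: vle_meet; exact: vabs_ge0.
Qed.

Lemma vdisjC x y : vdisj le x y -> vdisj le y x.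
Proof. by move/vdisjP => h; apply/vdisjP => z zy zx; exact: h. Qed.

Lemma vdisj_id x : vdisj le x x -> x = 0.
Proof. by move/vdisjP => h; apply/vabs_eq0/h; exact: vle_refl. Qed.

Lemma vdisj_le x y z : vdisj le y z -> le (vabs le x) (vabs le y) -> vdisj le x z.
Proof.
move=> /vdisjP h xy; apply/vdisjP => w wx wz.
by apply: h => //; exact: vle_trans xy.
Qed.

(** If [w] is below [|x + y|] and [|z|], then [w - |y|] is below [|x|] and [|z|], hence below 0; so
    [w] is a common lower bound of [|y|] and [|z|]. *)
Lemma vdisjD x y z : vdisj le x z -> vdisj le y z -> vdisj le (x + y) z.
Proof.
move=> /vdisjP hx /vdisjP hy; apply/vdisjP => w wxy wz.
apply: (hy) => //; rewrite -[vabs le y]add0r; apply/vle_subl_addr; apply: hx.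
  by apply/vle_subl_addr/(vle_trans wxy)/vabsD.
by apply: vle_trans wz; apply/vle_sub_id/vabs_ge0.
Qed.

Lemma vdisj0 y : vdisj le 0 y.
Proof. by apply/vdisjP => z; rewrite vabs0. Qed.

(** Additivity settles integer multiples of [|x|], and one of these dominates [|a *: x|]. *)
Lemma vdisjZ (a : R) x y : vdisj le x y -> vdisj le (a *: x) y.
Proof.
move=> h; have hn n : vdisj le (vabs le x *+ n) y.
  elim: n => [|n IH]; first exact: vdisj0.
  rewrite mulrS; apply: vdisjD IH; apply: vdisj_le h _.
  by rewrite vabs_abs; exact: vle_refl.
apply: vdisj_le (hn (Num.bound `|a|)) _; apply: (vle_trans (vabsZ a x)).
apply: vle_trans (vle_abs _); rewrite -scaler_nat.
apply/vsub_ge0; rewrite -scalerBl -(scaler0 _ ((Num.bound `|a|)%:R - `|a|)).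
by apply: vle_scale (vabs_ge0 x); rewrite subr_ge0 ltW// archi_boundP.
Qed.

Lemma dcompl_subspace A : lin_subspace (dcompl le A).
Proof.
split; first by move=> y _; exact: vdisj0.
split=> [x y hx hy z Az|a x hx z Az].
  by apply: vdisjD; [exact: hx|exact: hy].
by apply: vdisjZ; exact: hx.
Qed.

Lemma dcomplS A B : A `<=` B -> dcompl le B `<=` dcompl le A.
Proof. by move=> AB x hx y /AB; exact: hx. Qed.

Lemma band_gen_interval x y : le 0 x -> vinterval le x y -> band_gen le x y.
Proof.
move=> x0 [y0 yx] z hz; apply: (@vdisj_le _ x); last by rewrite !vabs_id.
by apply: vdisjC; exact: hz.
Qed.

Lemma band_gen_disj x y : band_gen le x y -> vdisj le y x -> y = 0.
Proof. by move=> hy yx; apply: vdisj_id; apply: hy => _ ->. Qed.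

(** An increasing net order converges to its supremum: the decreasing net [l - f i], over the same
    index set, dominates the error. *)
Lemma vl_is_sup_directed_closed (I : Type) (r : I -> I -> Prop) (f : I -> V) l S :
  order_closed le S -> vl_directed r -> (forall i k, r i k -> le (f i) (f k)) ->
  vl_is_sup le (range f) l -> (forall i, S (f i)) -> S l.
Proof.
move=> cS dr fmon [ub lub] Sf; apply: (cS I r f l dr Sf).
exists I, r, (fun i => l - f i); split=> //; split.
  by move=> i k rik; rewrite ![l - _]addrC; apply/vle_add2r/vle_opp/fmon.
split; first split.
- by move=> _ [i _ <-]; apply/vsub_ge0/ub; exists i.
- move=> t lbt; rewrite -(subrr l); apply/vle_subr_addr.
  rewrite addrC; apply/vle_subr_addr; apply: lub => _ [i _ <-].
  apply/vle_subr_addr; rewrite addrC; apply/vle_subr_addr.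
  by apply: lbt; exists i.
- move=> b; exists b => i rbi; rewrite -vabsN opprB vabs_id.
    by rewrite ![l - _]addrC; apply/vle_add2r/vle_opp/fmon.
  by apply/vsub_ge0/ub; exists i.
Qed.

End VectorLatticeTheory.

(** * Order dense sets and bands in Archimedean vector lattices *)

Section DenseSup.
Context {R : realType} {V : lmodType R} {le : V -> V -> Prop}.
Context (vl : vector_lattice le) (arch : archimedean le).
Implicit Types (x y z : V) (P K : set V).

(** For an upper bound [t] not above [x], the gap [w] between [x] and the meet of [x] and [t]
    dominates some non-zero positive [p] in [P]. If [p *+ n] lies in [P] and below [x], it is below
    [t] too, so adding [p <= w] stays below [x]. Thus all multiples of [p] are below [x], against
    the Archimedean property. *)
Lemma dense_is_sup P x : P 0 -> (forall y z, P y -> P z -> P (y + z)) -> le 0 x ->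
  (forall w, le 0 w -> le w x -> w <> 0 -> exists p, [/\ P p, le 0 p, le p w & p <> 0]) ->
  vl_is_sup le (fun p => P p /\ vinterval le x p) x.
Proof.
move=> P0 PD x0 dP; split=> [p [_ [_ px]]//|t ubt].
pose w := x - vmeet le x t.
have w0 : le 0 w by apply/(vsub_ge0 vl)/(vmeet_lel vl).
have [weq0|wn0] := pselect (w = 0).
  have -> : x = vmeet le x t by apply/eqP; rewrite -subr_eq0; apply/eqP.
  exact: vmeet_ler.
have t0 : le 0 t by apply: ubt; do 2?split=> //; exact: vle_refl.
have wx : le w x by apply: vle_sub_id => //; exact: vle_meet.
have [p [Pp p0 pw pn0]] := dP _ w0 wx wn0.
case: pn0; apply: (arch (y := x) p0) => n.
suff [//] : le (p *+ n) x /\ P (p *+ n) /\ le 0 (p *+ n).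
elim: n => [|n [nx [Pn n0]]]; first by rewrite mulr0n; do ?split=> //; exact: vle_refl.
rewrite mulrSr; split; last first.
  by split; [exact: PD|apply: (vle_trans vl n0); exact: vle_addr].
have -> : x = vmeet le x t + w by rewrite addrC subrK.
apply: (vle_add vl _ pw); apply: (vle_meet vl) => //.
exact: ubt.
Qed.

(* Contrapositive of: in an Archimedean vector lattice a band is its own double
   disjoint complement. *)
Lemma band_dcompl_witness K x : K 0 -> (forall y z, K y -> K z -> K (y + z)) ->
  (forall y z, K y -> le (vabs le z) (vabs le y) -> K z) -> order_closed le K ->
  ~ K x -> exists y, [/\ dcompl le K y, le 0 y, le y (vabs le x) & y <> 0].
Proof.
move=> K0 KD Ksolid Kclosed nKx; apply: contrapT => none; apply: nKx.
have x0 := vabs_ge0 vl x.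
suff Kabs : K (vabs le x) by apply: (Ksolid _ _ Kabs); rewrite vabs_abs//; exact: vle_refl.
have sup_x : vl_is_sup le (fun p => K p /\ vinterval le (vabs le x) p) (vabs le x).
  apply: dense_is_sup => // w w0 wx wn0.
  (* If [K] had no non-zero positive element below [w], then [w] would be the excluded witness: for
     a common lower bound [v] of [w] and [|k|], the positive part of [v] is in [K] and below [w],
     hence zero. *)
  apply: contrapT => noP; apply: none; exists w; split=> // k Kk.
  apply/(vdisjP vl) => v; rewrite (vabs_id vl w0) => vw vk.
  have p0 : le 0 (vjoin le v 0) by exact: vle_joinr.
  have [<-|pn0] := pselect (vjoin le v 0 = 0); first exact: vle_joinl.
  case: noP; exists (vjoin le v 0); split=> //.
    apply: (Ksolid _ _ Kk); rewrite (vabs_id vl p0).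
    by apply: (vjoin_le vl) vk _; exact: vabs_ge0.
  exact: vjoin_le.
pose Q p := K p /\ vinterval le (vabs le x) p.
apply: (@vl_is_sup_directed_closed _ _ _ vl {p | Q p} (fun a b => le (sval a) (sval b)) sval) => //.
- split; first by exists (exist Q 0 (conj K0 (conj (vle_refl vl 0) x0))).
  split=> [i|]; first exact: vle_refl.
  split=> [i j k|[a [Ka [a0 ax]]] [b [Kb [b0 bx]]]]; first exact: vle_trans.
  (* Directedness: the join of [a] and [b] is in [K] because [a + b] dominates it. *)
  have ab0 : le 0 (vjoin le a b) by apply: (vle_trans vl a0); exact: vle_joinl.
  have h : Q (vjoin le a b).
    split; last by split=> //; exact: vjoin_le.
    apply: (Ksolid (a + b)); first exact: KD.
    rewrite (vabs_id vl ab0) (vabs_id vl).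
      by apply: (vjoin_le vl); [exact: vle_addr|exact: vle_addl].
    by apply: (vle_trans vl a0); exact: vle_addr.
  by exists (exist Q _ h); split; [exact: vle_joinl|exact: vle_joinr].
- case: sup_x => ub lub; split=> [_ [[p hp] _ <-]|t ubt]; first exact: ub.
  by apply: lub => p hp; apply: ubt; exists (exist Q p hp).
- by case=> p [].
Qed.

End DenseSup.

(** * The carrier of a Fatou topology and the three countability criteria *)

Section Carrier.
Context {R : realType} {V : lmodType R} {le : V -> V -> Prop} {M : set (set V)}.
Context (vl : vector_lattice le) (arch : archimedean le) (fM : fatou le M).
Implicit Types (x y z : V) (T W : nat -> set V).

Definition fatou_normal W : Prop :=
  (forall n, M (W n) /\ solid_in le setT (W n) /\ order_closed le (W n)) /\
  forall n x y, W n.+1 x -> W n.+1 y -> W n (x + y).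

Lemma exists_fatou_normal T : (forall n, M (T n)) ->
  exists W, fatou_normal W /\ forall n, W n `<=` T n.
Proof.
move=> MT; case: fM => [[[_ [_ [_ [_ [MI [_ [MD _]]]]]]] _] fat].
pose good (nU : nat * set V) (S : set V) := M nU.2 ->
  [/\ M S, solid_in le setT S, order_closed le S, S `<=` T nU.1 &
    forall x y, S x -> S y -> nU.2 (x + y)].
have [f fP] : {f & forall nU, good nU (f nU)}.
  (* [good] is vacuous when [U] is not a neighbourhood, so [U] itself serves as default value
     there. *)
  apply: choice => -[n U]; have [MU|nMU] := pselect (M U); last by exists U.
  have [S1 [MS1 S1U]] := MD _ MU.
  have [S [MS [SS1 [solS clS]]]] := fat _ (MI _ _ (MT n) MS1).
  exists S => _; split=> //; first by move=> x /SS1[].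
  by move=> x y /SS1[_ /S1U +] /SS1[_]; apply.
pose W := fix W n := if n is m.+1 then f (n, W m) else f (0%N, setT).
have MW n : M (W n).
  elim: n => [|n IH]; last by case: (fP (n.+1, W n) IH).
  by case: (fP (0%N, setT)) => //=; case: fM => [[[_ [_ []]]]].
exists W; split; first split.
- case=> [|n]; last by case: (fP (n.+1, W n) (MW n)).
  by case: (fP (0%N, setT)) => //=; case: fM => [[[_ [_ []]]]].
- by move=> n x y; case: (fP (n.+1, W n) (MW n)) => _ _ _ _; apply.
- case=> [|n]; last by case: (fP (n.+1, W n) (MW n)).
  by case: (fP (0%N, setT)) => //=; case: fM => [[[_ [_ []]]]].
Qed.

Lemma fatou_normal_0 W n : fatou_normal W -> W n 0.
Proof.
by move=> [/(_ n)[MW _] _]; case: fM => [[[_ [_ [_ [_ [_ [h _]]]]]] _] _]; exact: h.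
Qed.

Lemma fatou_normal_solid W n x y :
  fatou_normal W -> W n x -> le (vabs le y) (vabs le x) -> W n y.
Proof. by move=> [/(_ n)[_ [[_ h] _]] _] Wx yx; exact: (h x). Qed.

Lemma fatou_normal_decr W m n : fatou_normal W -> (m <= n)%N -> W n `<=` W m.
Proof.
move=> hW /subnKC <-; elim: (n - m)%N => [|k IH] x; first by rewrite addn0.
rewrite addnS => Wx; apply: IH; rewrite -[x]addr0.
by case: (hW) => _; apply=> //; exact: fatou_normal_0.
Qed.

(** Shrinking [T] to a normal solid sequence shrinks the kernel and so enlarges its disjoint
    complement; arbitrary sequences of neighbourhoods therefore suffice. *)
Lemma carrierP x : carrier le M x <->
  exists T, (forall n, M (T n)) /\ dcompl le (fun y => forall n, T n y) x.
Proof.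
split=> [[T [hT dx]]|[T [MT dx]]].
  by exists T; split=> // n; case: (hT n).
have [W [[hW WD] WT]] := exists_fatou_normal MT.
exists W; split; first by move=> n; case: (hW n) => ? []; split=> //; split=> // ??; exact: WD.
by apply: (dcomplS _ dx) => y Wy n; exact: WT.
Qed.

(** Countably many sequences are merged into one, whose kernel lies in the kernel of each of
    them. *)
Lemma carrier_countable (A : set V) : countable A -> A `<=` carrier le M ->
  exists T, (forall n, M (T n)) /\ A `<=` dcompl le (fun y => forall n, T n y).
Proof.
move=> /countable_injP[f finj] AC.
have hT k : exists T, (forall n, M (T n)) /\
    forall a, A a -> f a = k -> dcompl le (fun y => forall n, T n y) a.
  have [[a [Aa <-]]|none] := pselect (exists a, A a /\ f a = k).
    have /carrierP[T [MT da]] := AC a Aa; exists T; split=> // b Ab fba.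
    by have -> : b = a by apply: finj; rewrite ?inE.
  exists (fun=> setT); split=> [_|a Aa fa]; first by case: fM => [[[_ [_ []]]]].
  by case: none; exists a.
have [S hS] := choice hT.
(* Every [S k m] occurs at the code of the pair [(k, m)]; numbers coding no pair receive the whole
   space. *)
exists (fun n => if unpickle n is Some (k, m) then S k m else setT); split=> [n|a Aa].
  case: (unpickle n) => [[k m]|]; first by case: (hS k).
  by case: fM => [[[_ [_ []]]]].
case: (hS (f a)) => _ /(_ a Aa erefl); apply: (dcomplS) => y Ty m.
by have := Ty (pickle (f a, m)); rewrite pickleK.
Qed.

Lemma carrierD x y : carrier le M x -> carrier le M y -> carrier le M (x + y).
Proof.
move=> cx cy; have [] := @carrier_countable ([set x] `|` [set y]).
- exact/finite_set_countable/finite_set2.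
- by move=> _ [->|->].
move=> T [MT h]; apply/carrierP; exists T; split=> //.
by have [_ [+ _]] := dcompl_subspace vl (fun y => forall n, T n y); apply; apply: h; [left|right].
Qed.

(** By the Hausdorff property some neighbourhood [U] misses [x]. The kernel of a Fatou normal
    sequence inside [U] is a band without [x], and its disjoint complement lies in the carrier. *)
Lemma carrier_dense x : x <> 0 ->
  exists y, [/\ carrier le M y, le 0 y, le y (vabs le x) & y <> 0].
Proof.
move=> xn0; case: (fM) => [[[_ [_ [_ [_ [_ [_ [_ [_ [_ haus]]]]]]]]] _] _].
have [U [MU nUx]] := haus x I xn0.
have [W [hW WU]] := @exists_fatou_normal (fun=> U) (fun=> MU).
have [|||||y [dy y0 yx yn0]] := @band_dcompl_witness _ _ _ vl arch (fun y => forall n, W n y) x.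
- by move=> n; exact: fatou_normal_0.
- by move=> y z Wy Wz n; case: hW => _; apply.
- by move=> y z Wy zy n; apply: (fatou_normal_solid hW (Wy n)).
- move=> I r f l dr Wf fl n; case: hW => /(_ n)[_ [_ /(_ I r f l dr)]] + _.
  by apply=> // i; exact: Wf.
- by move=> h; apply: nUx; exact: (WU 0%N).
exists y; split=> //; apply/carrierP; exists W; split=> // n.
by case: hW => /(_ n)[].
Qed.

Lemma carrier_setT_of_kernel T : (forall n, M (T n)) ->
  (forall y, (forall n, T n y) -> y = 0) -> carrier le M = setT.
Proof.
move=> MT T0; apply/seteqP; split=> // x _; apply/carrierP; exists T; split=> //.
by move=> y /T0 ->; apply: (vdisjC vl); exact: vdisj0.
Qed.

(** By density [|x|] is the supremum of the carrier elements in [[0, |x|]], hence of countably many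
    of them. One sequence [T] serves all of these, and disjointness from its kernel passes to the
    supremum. *)
Lemma carrier_countable_sup : countable_sup_property le -> carrier le M = setT.
Proof.
move=> csp; apply/seteqP; split=> // x _.
have sup_x : vl_is_sup le (fun p => carrier le M p /\ vinterval le (vabs le x) p) (vabs le x).
  apply: dense_is_sup => //.
  - by apply/carrierP; exists (fun=> setT); split=> [_|y _]; [case: fM => [[[_ [_ []]]]]|exact: vdisj0].
  - exact: carrierD.
  - exact: vabs_ge0.
  - move=> w w0 _ /carrier_dense[p [cp p0]]; rewrite (vabs_id vl w0) => pw pn0.
    by exists p.
have [A [Asub [cA [ubA lubA]]]] := csp _ _ sup_x.
have [T [MT AT]] := carrier_countable cA (fun a Aa => proj1 (Asub a Aa)).
apply/carrierP; exists T; split=> // y Ty; apply/(vdisjP vl) => z zx zy.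
pose z' := vjoin le z 0.
have z'0 : le 0 z' by exact: vle_joinr.
have z'x : le z' (vabs le x) by apply: (vjoin_le vl zx); exact: vabs_ge0.
have z'y : le z' (vabs le y) by apply: (vjoin_le vl zy); exact: vabs_ge0.
apply: (vle_trans vl (vle_joinl vl z 0)).
(* It is enough that [|x| - z'] is still an upper bound of [A]: leastness of [|x|] then gives
   [z' <= 0]. *)
suff /(vle_subr_addr vl) : le (vabs le x) (vabs le x - z').
  by rewrite addrC => /(vle_subr_addr vl); rewrite subrr.
apply: lubA => a Aa; have [_ [a0 ax]] := Asub a Aa.
have /(vdisjP vl) daz : vdisj le a z'.
  apply: (vdisjC vl); apply: (@vdisj_le _ _ _ vl _ y); last by rewrite (vabs_id vl z'0).
  by apply: (vdisjC vl); exact: AT.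
move: daz; rewrite (vabs_id vl a0) (vabs_id vl z'0) => daz.
(* [a + z' - |x|] is below both [a] and [z'], which are disjoint. *)
have aM : le (a + z' - vabs le x) 0.
  apply: daz; apply/(vle_subl_addr vl); first by apply: (vle_add vl) => //; exact: vle_refl.
  by rewrite addrC; apply: (vle_add vl) => //; exact: vle_refl.
by apply/(vle_subr_addr vl); move/(vle_subl_addr vl): aM; rewrite add0r.
Qed.

(** A non-zero element of the kernel of [W] would dominate a non-zero carrier element [z]; by
    solidity [z] lies in the kernel too, so it is disjoint from the whole order basis. *)
Lemma carrier_countable_basis :
  (exists A : set V, countable A /\ order_basis le (carrier le M) A) ->
  carrier le M = setT.
Proof.
move=> [A [cA [_ [AC basis]]]]; have [T [MT AT]] := carrier_countable cA AC.
have [W [hW WT]] := exists_fatou_normal MT.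
apply: (@carrier_setT_of_kernel W) => [n|y Wy]; first by case: hW => /(_ n)[].
apply: contrapT => /carrier_dense[z [cz z0 zy]]; apply; apply: basis => // a Aa.
apply: (vdisjC vl); apply: AT => // n; apply: WT.
by apply: (fatou_normal_solid hW (Wy n)); rewrite (vabs_id vl z0).
Qed.

(** Neighbourhoods inside the balls of radius [1 / (n + 1)] about zero have trivial kernel. *)
Lemma carrier_metrisable : metrisable setT M -> carrier le M = setT.
Proof.
move=> [d [d0 [deq [dC [dD dtop]]]]].
have hT n : exists T : set V, M T /\ forall w, T w -> d 0 w < n.+1%:R^-1.
  have [_ ball] := dtop 0 [set w | d 0 w < n.+1%:R^-1] I (fun _ _ => I).
  case: ball => [|T [MT hT]].
    by exists n.+1%:R^-1; split=> //; rewrite invr_gt0 ltr0n.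
  by exists T; split=> // w /hT/=; rewrite add0r.
have [T hT'] := choice hT; apply: (@carrier_setT_of_kernel T) => [n|y Ty].
  by case: (hT' n).
have [h _] := deq 0 y I I; apply/esym/h/eqP; rewrite eq_le d0// andbT.
apply/ler_addgt0Pl => e e0; rewrite addr0.
have := hT' (Num.bound e^-1) => -[_ /(_ _ (Ty _))] /ltW /le_trans; apply.
have einv0 : 0 < e^-1 by rewrite invr_gt0.
rewrite -[leRHS]invrK lef_pV2 ?posrE ?ltr0n//.
by rewrite (le_trans (ltW (archi_boundP (ltW einv0))))// ler_nat.
Qed.

End Carrier.

(** * Metrisation from a countable base at zero, after Birkhoff and Kakutani *)

Section Metrisation.
Context {R : realType} {V : lmodType R} (G : set V) (U : nat -> set V).
Context (G0 : G 0) (GD : forall x y, G x -> G y -> G (x + y)).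
Context (GN : forall x, G x -> G (- x)).
Context (UG : forall n, U n `<=` G) (U0 : forall n, U n 0).
Context (UN : forall n x, U n x -> U n (- x)).
Context (UD : forall n x y, U n.+1 x -> U n.+1 y -> U n (x + y)).
Implicit Types (x y z : V).

(* For [k < 2 ^ N] this is the sum of the [U n] over the binary digits
   [2 ^- (n + 1)] of [k / 2 ^ N]; a carry is absorbed by [U n.+1 + U n.+1 <= U n]. *)
Fixpoint dyadic_ball (N k : nat) x : Prop :=
  if N is N'.+1 then
    exists y z, dyadic_ball N' k./2 y /\ (if odd k then U N' z else z = 0) /\ x = y + z
  else if k == 0%N then x = 0 else G x.

Lemma dyadic_ball_at0 N x : dyadic_ball N 0 x <-> x = 0.
Proof.
elim: N x => [|N IH] x //=; split=> [[y [z [/IH -> [-> ->]]]]|->].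
  by rewrite addr0.
by exists 0, 0; rewrite addr0; split=> //; exact/IH.
Qed.

Lemma dyadic_ball1 N x : dyadic_ball N.+1 1 x <-> U N x.
Proof.
split=> [[y [z [/dyadic_ball_at0 -> [Uz ->]]]]|Ux]; first by rewrite add0r.
by exists 0, x; rewrite add0r; split=> //; exact/dyadic_ball_at0.
Qed.

Lemma dyadic_ballD N k l x y :
  dyadic_ball N k x -> dyadic_ball N l y -> dyadic_ball N (k + l) (x + y).
Proof.
elim: N k l x y => [|N IH] k l x y.
  case: k => [|k] /=; first by move=> ->; rewrite !add0n add0r.
  case: l => [|l] /=; first by move=> + ->; rewrite addr0.
  exact: GD.
move=> [y1 [z1 [hy1 [hz1 ->]]]] [y2 [z2 [hy2 [hz2 ->]]]].
have hy := IH _ _ _ _ hy1 hy2; rewrite /= halfD oddD addrACA.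
move: hz1 hz2; case: (odd k); case: (odd l) => /= hz1 hz2; rewrite ?add0n.
(* Both last digits are 1. The new last digit is 0, and [z1 + z2] is the carry, an element of the
   ball of index 1 at level [N]; at level 0 that ball is all of [G]. *)
- exists (z1 + z2 + (y1 + y2)), 0; split.
    apply: (IH 1%N) => {hy1 hy2}//; case: (N) hz1 hz2 => [|n] hz1 hz2.
      by apply: GD; [exact: UG hz1|exact: UG hz2].
    by apply/dyadic_ball1; exact: UD.
  by split=> //; rewrite addr0 addrC.
- by exists (y1 + y2), (z1 + z2); rewrite hz2 addr0.
- by exists (y1 + y2), (z1 + z2); rewrite hz1 add0r.
- by exists (y1 + y2), (z1 + z2); rewrite hz1 hz2 addr0.
Qed.

Lemma dyadic_ball0 N k : dyadic_ball N k 0.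
Proof.
elim: N k => [|N IH] k /=; first by case: eqP.
by exists 0, 0; rewrite addr0; split=> //; case: ifP.
Qed.

Lemma dyadic_ball_le N k l x : (k <= l)%N -> dyadic_ball N k x -> dyadic_ball N l x.
Proof.
by move=> /subnKC <- hx; rewrite -[x]addr0; exact/dyadic_ballD/dyadic_ball0.
Qed.

Lemma dyadic_ballN N k x : dyadic_ball N k x -> dyadic_ball N k (- x).
Proof.
elim: N k x => [|N IH] k x /=.
  by case: eqP => _; [move=> ->; rewrite oppr0|exact: GN].
move=> [y [z [hy [hz ->]]]]; exists (- y), (- z); rewrite opprD.
do 2?split=> //; first exact: IH.
by move: hz; case: (odd k) => [|->]; [exact: UN|rewrite oppr0].
Qed.

(** Trailing zero digits contribute only the vector 0, so radii can be brought to a common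
    denominator. *)
Lemma dyadic_ball_refine m N k x :
  dyadic_ball (m + N) (k * 2 ^ m) x <-> dyadic_ball N k x.
Proof.
elim: m => [|m IH]; first by rewrite muln1.
rewrite -IH addSn expnS mulnCA mul2n /= doubleK odd_double.
split=> [[y [z [hy [-> ->]]]]|hx]; first by rewrite addr0.
by exists x, 0; rewrite addr0.
Qed.

Definition dyadic_radii x : set R :=
  [set r | exists N k, r = k%:R / 2 ^+ N /\ dyadic_ball N k x].

(** The Birkhoff-Kakutani functional, whose values on differences give the metric below. *)
Definition dyadic_norm x : R := inf (dyadic_radii x).

Let exp2_gt0 N : 0 < 2 ^+ N :> R. Proof. by rewrite exprn_gt0 ?ltr0n. Qed.

Lemma dyadic_radii_ge0 x : lbound (dyadic_radii x) 0.
Proof. by move=> _ [N [k [-> _]]]; rewrite divr_ge0 ?ler0n// ltW. Qed.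

Lemma dyadic_radii_nonempty x : G x -> dyadic_radii x !=set0.
Proof. by move=> Gx; exists (1 / 2 ^+ 0), 0%N, 1%N. Qed.

Lemma dyadic_norm_le x r : dyadic_radii x r -> dyadic_norm x <= r.
Proof. by apply: ge_inf; exists 0; exact: dyadic_radii_ge0. Qed.

Lemma dyadic_norm_ge0 x : G x -> 0 <= dyadic_norm x.
Proof.
by move=> /dyadic_radii_nonempty ne; apply: lb_le_inf ne _; exact: dyadic_radii_ge0.
Qed.

Lemma dyadic_norm0 : dyadic_norm 0 = 0.
Proof.
apply/eqP; rewrite eq_le dyadic_norm_ge0// andbT; apply: dyadic_norm_le.
by exists 0%N, 0%N; rewrite mul0r.
Qed.

Lemma dyadic_normN x : dyadic_norm (- x) = dyadic_norm x.
Proof.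
congr inf; apply/seteqP; split=> _ [N [k [-> /dyadic_ballN hx]]]; exists N, k => //.
by rewrite -[x]opprK.
Qed.

Lemma dyadic_normD x y : G x -> G y ->
  dyadic_norm (x + y) <= dyadic_norm x + dyadic_norm y.
Proof.
move=> Gx Gy; rewrite -lerBlDr; apply: lb_le_inf; first exact: dyadic_radii_nonempty.
move=> r [N [k [rE hx]]]; rewrite lerBlDr -lerBlDl.
apply: lb_le_inf; first exact: dyadic_radii_nonempty.
move=> s [M [l [sE hy]]]; rewrite lerBlDl; apply: dyadic_norm_le.
(* Both radii are written over the denominator [2 ^ (M + N)]. *)
exists (M + N)%N, (k * 2 ^ M + l * 2 ^ N)%N; split.
  have nz n : 2 ^+ n != 0 :> R by rewrite gt_eqF.
  rewrite rE sE natrD !natrM !natrX exprD mulrDl; congr (_ + _).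
    by rewrite [2 ^+ M * _]mulrC -mulf_div divff// mulr1.
  by rewrite -mulf_div divff// mulr1.
apply: dyadic_ballD; first exact/dyadic_ball_refine.
by rewrite addnC; exact/dyadic_ball_refine.
Qed.

Lemma dyadic_norm_lt n x : G x -> dyadic_norm x < 2 ^- n.+1 -> U n x.
Proof.
move=> /dyadic_radii_nonempty ne /(inf_lt ne)[_ [N [k [-> hx]]]].
(* Cross multiplication gives [k * 2 ^ n.+1 < 2 ^ N], which compares the two balls at the common
   level [n.+1 + N]. *)
rewrite ltr_pdivrMr// mulrC ltr_pdivlMr// -!natrX -natrM ltr_nat => kN.
apply/dyadic_ball1/(dyadic_ball_refine N); rewrite mul1n addnC.
by apply: (dyadic_ball_le (ltnW kN)); exact/dyadic_ball_refine.
Qed.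

Lemma dyadic_norm_ball n x : U n x -> dyadic_norm x <= 2 ^- n.+1.
Proof.
move=> Ux; apply: dyadic_norm_le; exists n.+1, 1%N.
by rewrite mul1r; split=> //; exact/dyadic_ball1.
Qed.

Lemma exists_exp2V_lt (e : R) : 0 < e -> exists n, 2 ^- n < e.
Proof.
move=> e0; have einv0 : 0 < e^-1 by rewrite invr_gt0.
exists (Num.bound e^-1); rewrite -[ltRHS]invrK ltf_pV2 ?posrE//.
apply: (lt_trans (archi_boundP (ltW einv0))).
by rewrite -natrX ltr_nat ltn_expl.
Qed.

(** [dyadic_norm (x - y)] is the metric: norm below [2 ^- n.+1] forces membership in [U n], and on
    [U n] the norm is at most [2 ^- n.+1]. *)
Lemma metrisable_countable_basis (M : set (set V)) :
  (forall n, M (U n)) -> (forall S, M S -> exists n, U n `<=` S) ->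
  (forall x, (forall n, U n x) -> x = 0) -> metrisable G M.
Proof.
move=> MU Ubasis sep; exists (fun x y => dyadic_norm (x - y)).
have GB x y : G x -> G y -> G (x - y) by move=> Gx /GN; exact: GD.
split; first by move=> x y Gx Gy; exact/dyadic_norm_ge0/GB.
split.
  move=> x y Gx Gy; split=> [d0|->]; last by rewrite subrr dyadic_norm0.
  apply/eqP; rewrite -subr_eq0; apply/eqP; apply: sep => n.
  by apply: dyadic_norm_lt; [exact: GB|rewrite d0 invr_gt0].
split; first by move=> x y _ _; rewrite -dyadic_normN opprB.
split.
  move=> x y z Gx Gy Gz; rewrite -[x - z](subrKA y).
  by apply: dyadic_normD; exact: GB.
move=> x S Gx SG; split=> [[W [MW WS]]|[e [e0 eS]]].
  have [n UW] := Ubasis _ MW; exists (2 ^- n.+1); split; first by rewrite invr_gt0.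
  move=> y Gy; rewrite -dyadic_normN opprB => dxy.
  rewrite -[y](subrK x) addrC; apply/WS/UW/dyadic_norm_lt => //; exact: GB.
have [n ne] := exists_exp2V_lt e0; exists (U n); split=> // w Uw.
apply: eS; first by apply: GD => //; exact: UG Uw.
rewrite opprD addNKr dyadic_normN; apply: (le_lt_trans (dyadic_norm_ball Uw)).
by apply: le_lt_trans ne; rewrite lef_pV2 ?posrE// ler_eXn2l ?ler1n// ltr1n.
Qed.

End Metrisation.

(** * Completeness of order intervals in a Dedekind complete Fatou space *)

Section IntervalCompleteness.
Context {R : realType} {V : lmodType R} {le : V -> V -> Prop} {M : set (set V)}.
Context (vl : vector_lattice le) (fM : fatou le M) (dc : dedekind_complete le).
Context (W : nat -> set V) (hW : fatou_normal (le := le) (M := M) W).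

(** The first term is in [W m.+1] and, by induction, so is the sum of the others; normality puts the
    total in [W m]. *)
Lemma fatou_normal_sum (a : nat -> V) q m :
  (forall k, W k (a k)) -> W m (\sum_(i < q) a (m.+1 + i)%N).
Proof.
move=> Wa; elim: q m => [|q IH] m.
  by rewrite big_ord0; exact: fatou_normal_0 hW.
rewrite big_ord_recl addn0; case: (hW) => _; apply; first exact: Wa.
under eq_bigr do rewrite lift0 addnS -addSn.
exact: IH.
Qed.

(* The sum of the increments is truncated at [x], which makes its supremum
   [t] exist; [t] stays in [W m] because [W m] is order closed. *)
Lemma uniform_tail_bound (x : V) (v : nat -> V) m :
  (forall n, vinterval le x (v n)) -> (forall k, W k (v k.+1 - v k)) ->
  exists t, W m t /\ le 0 t /\
    forall p, (m < p)%N -> le (vabs le (v p - v m.+1)) t.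
Proof.
move=> vx Wv.
have x0 : le 0 x by case: (vx 0%N) => v0 vx0; exact: vle_trans vx0.
pose S p := \sum_(i < p) vabs le (v (m.+1 + i).+1 - v (m.+1 + i)%N).
have SS p : S p.+1 = S p + vabs le (v (m.+1 + p).+1 - v (m.+1 + p)%N).
  by rewrite /S big_ord_recr.
have S0 p : le 0 (S p).
  elim: p => [|p IH]; first by rewrite /S big_ord0; exact: vle_refl.
  by rewrite SS; apply: (vle_trans vl IH); apply: vle_addr => //; exact: vabs_ge0.
pose s p := vmeet le x (S p).
have s0 p : le 0 (s p) by exact: vle_meet.
have WS p : W m (S p).
  apply: (fatou_normal_sum (a := fun k => vabs le (v k.+1 - v k))) => k.
  by apply: (fatou_normal_solid hW (Wv k)); rewrite vabs_abs//; exact: vle_refl.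
have Ws p : W m (s p).
  apply: (fatou_normal_solid hW (WS p)); rewrite !(vabs_id vl)//; exact: vmeet_ler.
have smon p q : (p <= q)%N -> le (s p) (s q).
  move=> /subnKC <-; elim: (q - p)%N => [|k IH]; first by rewrite addn0; exact: vle_refl.
  apply: (vle_trans vl IH); apply: (vle_meet vl); first exact: vmeet_lel.
  apply: (vle_trans vl (vmeet_ler vl _ _)); rewrite addnS SS.
  by apply: vle_addr => //; exact: vabs_ge0.
have [t sup_t] : exists t, vl_is_sup le (range s) t.
  apply: dc; first by exists (s 0%N), 0%N.
  by exists x => _ [p _ <-]; exact: vmeet_lel.
have st p : le (s p) t by case: sup_t => ub _; apply: ub; exists p.
exists t; split.
  case: (hW) => /(_ m)[_ [_ clW]] _.
  apply: (vl_is_sup_directed_closed vl clW (r := fun p q : nat => (p <= q)%N) _ smon sup_t Ws).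
  split; first by exists 0%N.
  split; first by [].
  split; first by move=> i j k; exact: leq_trans.
  by move=> i j; exists (maxn i j); rewrite leq_maxl leq_maxr.
split; first exact: vle_trans (s0 0%N) (st 0%N).
move=> p /subnKC <-; apply: (vle_trans vl _ (st (p - m.+1)%N)).
have hle a b : vinterval le x a -> vinterval le x b -> le (a - b) x.
  by move=> [_ ax] [b0 _]; apply: (vle_trans vl (vle_sub_id vl a b0)).
(* The difference of two points of [[0, x]] has modulus at most [x]; telescoping bounds it by [S] as
   well. *)
apply: (vle_meet vl); first by apply: (vabs_le vl); rewrite ?opprB; exact: hle.
elim: (p - m.+1)%N => [|k IH].
  by rewrite addn0 subrr vabs0// /S big_ord0; exact: vle_refl.
rewrite SS addnS -(subrKA (v (m.+1 + k)%N)) addrC.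
by apply: (vle_trans vl (vabsD vl _ _)); apply: vle_add => //; exact: vle_refl.
Qed.

(** Along a fast subsequence [v], with tail bounds [t], the limit is the supremum of the lower
    estimates [v m.+1 - t m]. Each of them is below every upper estimate [v p.+1 + t p], whence
    [|v m.+1 - y| <= t m]. *)
Lemma interval_cauchy_conv (x : V) (u : nat -> V) :
  (forall n, vinterval le x (u n)) ->
  (forall k, exists n0, forall m n, (n0 <= m)%N -> (n0 <= n)%N -> W k (u m - u n)) ->
  exists y, vinterval le x y /\
    forall k, exists n0, forall n, (n0 <= n)%N -> W k (u n - y).
Proof.
move=> ux /choice[g gP].
have x0 : le 0 x by case: (ux 0%N) => u0 ux0; exact: vle_trans ux0.
(* A running maximum, so that [h k] and [h k.+1] both lie beyond the threshold [g k]. *)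
pose h k := \max_(i < k.+1) g i.
have gh k j : (k <= j)%N -> (g k <= h j)%N.
  by move=> kj; exact: (leq_bigmax_cond (F := fun i : 'I_j.+1 => g i) (Ordinal (n := j.+1) (m := k) kj)).
pose v k := u (h k).
have vx n : vinterval le x (v n) by exact: ux.
have Wv k : W k (v k.+1 - v k) by apply: gP; exact: gh.
have /choice[t tP] m := uniform_tail_bound m vx Wv.
have t0 m : le 0 (t m) by case: (tP m) => _ [].
(* Adjoining 0 to the family forces [0 <= y]. *)
have [y [uby luby]] : exists y,
    vl_is_sup le (fun z => z = 0 \/ exists m, z = v m.+1 - t m) y.
  apply: dc; first by exists 0; left.
  exists x => _ [->//|[m ->]]; apply: (vle_trans vl (vle_sub_id vl _ (t0 m))).
  by case: (vx m.+1).
(* Only the tail bound with the smaller index is used; the other is dropped by positivity. *)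
have vty m p : le (v m.+1 - t m) (v p.+1 + t p).
  have [mp|pm] := leqP m p.
    have [_ [_ /(_ p.+1 mp) tm]] := tP m.
    apply: (vle_trans vl _ (vle_addr vl (v p.+1) (t0 p))).
    apply/(vle_subl_addr vl); rewrite addrC; apply/(vle_subl_addr vl).
    by apply: (vle_trans vl _ tm); rewrite -vabsN// opprB; exact: vle_abs.
  have [_ [_ /(_ m.+1 (leqW pm)) tp]] := tP p.
  apply: (vle_trans vl (vle_sub_id vl _ (t0 m))).
  rewrite addrC; apply/(vle_subl_addr vl).
  by apply: (vle_trans vl _ tp); exact: vle_abs.
exists y; split.
  split; first by apply: uby; left.
  apply: luby => _ [->//|[m ->]]; apply: (vle_trans vl (vle_sub_id vl _ (t0 m))).
  by case: (vx m.+1).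
have vyt m : W m (v m.+1 - y).
  have [Wt _] := tP m; apply: (fatou_normal_solid hW Wt).
  rewrite (vabs_id vl (t0 m)); apply: (vabs_le vl).
    apply/(vle_subl_addr vl); rewrite addrC; apply/(vle_subl_addr vl).
    by apply: uby; right; exists m.
  rewrite opprB; apply/(vle_subl_addr vl); rewrite addrC.
  apply: luby => _ [->|[p ->]]; last exact: vty.
  by apply: (vle_trans vl (t0 m)); apply: vle_addl => //; case: (vx m.+1).
(* Both [u n - v k.+2] and [v k.+2 - y] lie in [W k.+1], so their sum lies in [W k]. *)
move=> k; exists (g k.+1) => n gn; rewrite -(subrKA (v k.+2)).
case: (hW) => _; apply; last exact: vyt.
by apply: gP => //; exact: gh.
Qed.

End IntervalCompleteness.

(** * The metrisable topology on a principal band of the Dedekind completion *)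

Lemma dedekind_completion_lic (R : realType) (E F : lmodType R)
    (le : E -> E -> Prop) (leF : F -> F -> Prop) (j : E -> F)
    (N : set (set E)) (Nd : set (set F)) :
  vector_lattice le -> fatou le N -> carrier le N = setT ->
  dedekind_completion le leF j -> fatou leF Nd -> top_extends j N Nd ->
  lic_solidly_submetrisable leF Nd.
Proof.
move=> vl fN CT [vlF [dcF [jlin [jinj [jle [_ [jdense jcof]]]]]]] fNd ext x x0.
have j0 : j 0 = 0.
  by have := jlin (-1) 0 0; rewrite scaler0 addr0 scaleN1r addNr.
have [e xe] := jcof x.
have e0 : le 0 e by apply/jle; rewrite j0; exact: vle_trans xe.
have /(carrierP fN)[T [NT de]] : carrier le N e by rewrite CT.
(* The extension property yields neighbourhoods in the completion whose traces on [E] lie inside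
   [T n]. *)
have /choice[T' T'P] n : exists S, Nd S /\ j @^-1` S `<=` T n by apply/ext.
have [W [hW WT']] := exists_fatou_normal fNd (fun n => proj1 (T'P n)).
have NdW n : Nd (W n) by case: hW => /(_ n)[].
set B := band_gen leF x.
have [B0 [BD BZ]] : lin_subspace B by exact: dcompl_subspace.
(* A kernel element of the band is disjoint from [x], hence zero. Otherwise some [c] in [E]
   satisfies [0 < j c], with [j c] below [|y|] and [x]; then [c] is in the kernel of [T] and below
   [e], although [e] is disjoint from that kernel. *)
have sepW y : (forall n, W n y) -> B y -> y = 0.
  move=> Wy By; apply: (band_gen_disj vlF By).
  apply/(vdisjP vlF) => z zy zx.
  pose z' := vjoin leF z 0.
  apply: (vle_trans vlF (vle_joinl vlF z 0)); rewrite -/z'.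
  suff -> : z' = 0 by exact: vle_refl.
  apply: contrapT => z'n0; have z'0 : leF 0 z' by exact: vle_joinr.
  have [c [c0 [cn0 cz]]] := jdense _ z'0 z'n0; apply: cn0.
  have le0c : le 0 c by apply/jle; rewrite j0.
  suff c00 : le c 0 by rewrite (vle_anti vl c00 le0c).
  have z'e : leF z' (j e).
    apply: (vjoin_le vlF); last exact: vle_trans xe.
    by apply: (vle_trans vlF zx); rewrite (vabs_id vlF x0).
  have z'y : leF z' (vabs leF y) by apply: (vjoin_le vlF zy); exact: vabs_ge0.
  have Tc n : T n c.
    case: (T'P n) => _; apply; apply: WT'; apply: (fatou_normal_solid hW (Wy n)).
    by rewrite (vabs_id vlF c0); exact: vle_trans z'y.
  have /(vdisjP vl) := de c Tc; rewrite (vabs_id vl e0) (vabs_id vl le0c).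
  by apply; [apply/jle; exact: vle_trans z'e|exact: vle_refl].
have W0 n : W n 0 by exact: fatou_normal_0 hW.
have WZ (a : R) n y : `|a| <= 1 -> W n y -> W n (a *: y).
  move=> a1 Wy; apply: (fatou_normal_solid hW Wy).
  apply: (vle_trans vlF (vabsZ vlF _ _)); apply: vle_scale1 => //; exact: vabs_ge0.
pose Mx : set (set F) := [set S | S `<=` B /\ exists n, W n `&` B `<=` S].
have MxW n : Mx (W n `&` B) by split; [exact: subIsetr|exists n].
exists Mx; split; first split.
- split; first by split.
  split; first by move=> S [].
  split; first by split=> //; exists 0%N; exact: subIsetr.
  split.
    move=> S S' [_ [n nS]] SS' S'B; split=> //; exists n.
    exact: subset_trans SS'.
  split.
    move=> S S' [SB [n nS]] [S'B [n' nS']]; split; first by move=> y [/SB].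
    exists (maxn n n') => y [Wy By]; split; [apply: nS|apply: nS']; split=> //;
      by apply: (fatou_normal_decr fNd hW _ Wy); rewrite ?leq_maxl ?leq_maxr.
  split; first by move=> S [_ [n nS]]; apply: nS.
  split.
    move=> S [_ [n nS]]; exists (W n.+1 `&` B); split=> // y z [Wy By] [Wz Bz].
    by apply: nS; split; [case: hW => _; apply|exact: BD].
  split.
    move=> S [_ [n nS]]; exists (W n `&` B); do 2?split=> //.
    by move=> a y a1 [Wy By]; split; [exact: WZ|exact: BZ].
  split.
    move=> S y [_ [n nS]] By; case: (fNd) => [[[_ [_ [_ [_ [_ [_ [_ [_ [ab _]]]]]]]]] _] _].
    have [t [tpos tP]] := ab (W n) y (NdW n) I; exists t; split=> // a at_.
    by apply: nS; split; [exact: tP|exact: BZ].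
  move=> y By yn0; apply: contrapT => none; apply: yn0; apply: sepW => // n.
  by apply: contrapT => nWy; apply: none; exists (W n `&` B); split=> // -[].
- move=> S [_ [n nS]]; exists (W n `&` B); do 2?split=> //.
  split; first exact: subIsetr.
  by move=> y z [Wy By] Bz zy; split=> //; exact: fatou_normal_solid hW Wy zy.
split.
  apply: (@metrisable_countable_basis _ _ B (fun n => W n `&` B)) => //.
  - by move=> y By; rewrite -scaleN1r; exact: BZ.
  - by move=> n y [Wy By]; rewrite -scaleN1r; split; [apply: WZ; rewrite ?normrN1|exact: BZ].
  - by move=> n y z [Wy By] [Wz Bz]; split; [case: hW => _; apply|exact: BD].
  - by move=> S []; eauto.
  - by move=> y h; apply: sepW => [n|]; [case: (h n)|case: (h 0%N)].
split; first by move=> S [_ [n nS]]; exists (W n).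
move=> u ux uC.
have [||y [yx uy]] := @interval_cauchy_conv _ _ _ _ vlF fNd dcF W hW x u.
- exact: ux.
- move=> k; have [n0 n0P] := uC _ (MxW k); exists n0 => m n hm hn.
  by case: (n0P m n hm hn).
exists y; split=> // S [_ [k kS]]; have [n0 n0P] := uy k; exists n0 => n hn.
apply: kS; split; first exact: n0P.
(* Neighbourhoods in [Mx] are controlled by traces on [B], so the difference must also be shown to
   lie in the band. *)
have Bu := band_gen_interval vlF x0 (ux n); have By := band_gen_interval vlF x0 yx.
by apply: BD => //; rewrite -scaleN1r; exact: BZ.
Qed.

Theorem theorem3p17 (R : realType) (E : lmodType R) (le : E -> E -> Prop)
  (N : set (set E)) :
  vector_lattice le -> archimedean le -> fatou le N ->
  ((countable_sup_property le -> carrier le N = setT) /\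
   ((exists A : set E, countable A /\ order_basis le (carrier le N) A) ->
      carrier le N = setT) /\
   (metrisable setT N -> carrier le N = setT)) /\
  (carrier le N = setT ->
   forall (F : lmodType R) (leF : F -> F -> Prop) (j : E -> F)
          (Nd : set (set F)),
     dedekind_completion le leF j -> fatou leF Nd -> top_extends j N Nd ->
     lic_solidly_submetrisable leF Nd).
Proof.
move=> vl arch fN; split; last first.
  by move=> CT F leF j Nd; exact: dedekind_completion_lic.
split; first exact: carrier_countable_sup.
by split; [exact: carrier_countable_basis|exact: carrier_metrisable].
Qed.
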